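(* Let $S\subseteq[n]$ and $k\in S$. Suppose $\delta_i=0$ for $i\notin S$, and the vectors $\{\delta_j: j\in S\setminus\{k\}\}$ are random with a joint distribution $\mathcal{D}_k$ having finite first and second moments, while $\delta_k\in\mathbb{R}^n$ is deterministic. Let $(W',P')$ be the (random) stable point for $M'=M+\Delta$, where $\Delta e_i=\delta_i$. Then a vector $\delta_k\in\mathbb{R}^n$ maximizes agent $k$'s expected utility $\mathbb{E}_{\mathcal{D}_k}[g_k(W',P')]$ if and only if it solves the linear system $$T^{(k,k)}\delta_k+\sum_{j\in S,\ j\neq k}T^{(k,j)}\,\mathbb{E}_{\mathcal{D}_k}[\delta_j]=y_k .$$
   Context: Fix agents $[n]=\{1,\dots,n\}$. Let $\Sigma\in\mathbb{R}^{n\times n}$ be symmetric positive definite, $\Gamma=\mathrm{diag}(\gamma_1,\dots,\gamma_n)$ with all $\gamma_i>0$, and let $M\in\mathbb{R}^{n\times n}$ be the matrix of true beliefs with $i$-th column $\mu_i=Me_i$. For a matrix of reported negotiating positions $M'\in\mathbb{R}^{n\times n}$, the stable point for $M'$ is the unique pair $(W,P)$ of real $n\times n$ matrices with $W=W^T$, $P^T=-P$ and $M'-P=2\Sigma W\Gamma$; equivalently $\mathrm{vec}(W)=\tfrac12(\Gamma\otimes\Sigma+\Sigma\otimes\Gamma)^{-1}\mathrm{vec}(M'+M'^T)$ and $P=M'-2\Sigma W\Gamma$. Here $\mathrm{vec}$ stacks columns and $e_i$ is the $i$-th standard basis vector. Agent $i$'s (true) utility at $(W,P)$ is $g_i(W,P)=w_i^T(\mu_i-Pe_i)-\gamma_i\,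 w_i^T\Sigma w_i$, where $w_i=We_i$. Agent $i$'s negotiating position is $\mu_i'=\mu_i+\delta_i$. Matrices: $\Pi\in\mathbb{R}^{n^2\times n^2}$ is the commutation matrix, $\Pi\,\mathrm{vec}(X)=\mathrm{vec}(X^T)$ for all $X\in\mathbb{R}^{n\times n}$; $\Pi_k\in\mathbb{R}^{n\times n^2}$ satisfies $\Pi_k\mathrm{vec}(X)=Xe_k$. For $Z\in\mathbb{R}^{n^2\times n^2}$, $Z^{(p,q)}$ is its $n\times n$ block in block-row $p$ and block-column $q$. Set $K=\Gamma\otimes\Sigma+\Sigma\otimes\Gamma$ (invertible), $L=\tfrac12(K^{-1}+K^{-1}\Pi)$, $T^{(k,k)}=L^{(k,k)}+(L^{(k,k)})^T-2\gamma_k(L^{(k,k)})^T\Sigma L^{(k,k)}$, $T^{(k,j)}=(I-2\gamma_k(L^{(k,k)})^T\Sigma)L^{(k,j)}$ for $j\neq k$, and $y_k=\tfrac12\big(2\gamma_k(L^{(k,k)})^T\Sigma-I\big)\Pi_kK^{-1}\mathrm{vec}(M+M^T)$. *)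

(* Defs.v *)
From HB Require Import structures.
From mathcomp Require Import all_boot all_order all_algebra.
From mathcomp Require Import all_classical all_reals all_analysis.
Set Implicit Arguments. Unset Strict Implicit. Unset Printing Implicit Defensive.
Import Order.TTheory GRing.Theory Num.Theory.
Local Open Scope ring_scope.

Section Defs.
Variables (R : realType) (n : nat).

(* Index conventions: for p, a : 'I_n, the position (p * n + a) of 'I_(n*n)
   is [mxvec_index p a].  With column stacking, entry X a b of X sits at
   position b*n + a of vec(X), i.e. at [mxvec_index b a]; block (p,q) of an
   n^2 x n^2 matrix Z is the n x n matrix (a,b) |-> Z (p*n+a) (q*n+b). *)

Definition vecc (X : 'M[R]_n) : 'cV[R]_(n * n) :=
  \col_u (mxvec X^T) 0 u.

Definition kron (A B : 'M[R]_n) : 'M[R]_(n * n) :=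
  \sum_(p < n) \sum_(q < n) \sum_(a < n) \sum_(b < n)
     (A p q * B a b) *: delta_mx (mxvec_index p a) (mxvec_index q b).

Definition blk (Z : 'M[R]_(n * n)) (p q : 'I_n) : 'M[R]_n :=
  \matrix_(a, b) Z (mxvec_index p a) (mxvec_index q b).

(* commutation matrix: Pi vec(X) = vec(X^T) *)
Definition commPi : 'M[R]_(n * n) :=
  \sum_(a < n) \sum_(b < n) delta_mx (mxvec_index b a) (mxvec_index a b).

(* Pi_k : Pi_k vec(X) = X e_k *)
Definition Pik (k : 'I_n) : 'M[R]_(n, n * n) :=
  \sum_(a < n) delta_mx a (mxvec_index k a).

Definition Gam (gamma : 'I_n -> R) : 'M[R]_n := diag_mx (\row_i gamma i).

Definition Kmat (Sigma : 'M[R]_n) (gamma : 'I_n -> R) : 'M[R]_(n * n) :=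
  kron (Gam gamma) Sigma + kron Sigma (Gam gamma).

Definition Lmat Sigma gamma : 'M[R]_(n * n) :=
  2^-1 *: (invmx (Kmat Sigma gamma) + invmx (Kmat Sigma gamma) *m commPi).

Definition Tblk Sigma gamma (k j : 'I_n) : 'M[R]_n :=
  let Lkk := blk (Lmat Sigma gamma) k k in
  if j == k then Lkk + Lkk^T - (2 * gamma k) *: (Lkk^T *m Sigma *m Lkk)
  else (1%:M - (2 * gamma k) *: (Lkk^T *m Sigma)) *m blk (Lmat Sigma gamma) k j.

Definition yvec Sigma gamma (M : 'M[R]_n) (k : 'I_n) : 'cV[R]_n :=
  let Lkk := blk (Lmat Sigma gamma) k k in
  2^-1 *: (((2 * gamma k) *: (Lkk^T *m Sigma) - 1%:M) *m Pik k
            *m invmx (Kmat Sigma gamma) *m vecc (M + M^T)).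

Definition is_stable_point Sigma gamma (M' W P : 'M[R]_n) : Prop :=
  W^T = W /\ P^T = - P /\ M' - P = 2%:R *: (Sigma *m W *m Gam gamma).

Definition utility Sigma gamma (M : 'M[R]_n) (k : 'I_n) (W P : 'M[R]_n) : R :=
  let w := col k W in
  ((w^T *m (col k M - col k P)) - gamma k *: (w^T *m Sigma *m w)) 0 0.

Definition Delta {T : Type} (S : {set 'I_n}) (k : 'I_n)
  (delta : 'I_n -> T -> 'cV[R]_n) (d : 'cV[R]_n) (w : T) : 'M[R]_n :=
  \matrix_(i, j) (if j == k then d i 0
                  else if j \in S then delta j w i 0 else 0).

End Defs.

(* Main.v *)
(** Vectorizing the stability equation gives [w_k = sum_j L^(k,j) mu'_j], and
    [mu_k - P e_k = 2 gamma_k Sigma w_k - delta_k], so agent [k]'s utility is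
    [gamma_k w_k^T Sigma w_k - w_k^T delta_k] with [w_k] affine in [delta_k].
    Its expectation is therefore a quadratic in [delta_k], with Hessian
    [- T^(k,k)] and gradient [y_k] minus the left-hand side of the linear
    system.  Pairing the stability equation with [W] shows that [T^(k,k)] is
    positive semidefinite, hence the maximizers are the critical points. *)

Require Import Defs.
From HB Require Import structures.
From mathcomp Require Import all_boot all_order all_algebra.
From mathcomp Require Import all_classical all_reals all_analysis.
From mathcomp Require Import ring lra.
Set Implicit Arguments.
Unset Strict Implicit.
Unset Printing Implicit Defensive.
Import Order.TTheory GRing.Theory Num.Theory.
Local Open Scope ring_scope.

(** * Vectorization, Kronecker products and block rows *)

Lemma eq_mxvec_index (m n : nat) (i p : 'I_m) (j q : 'I_n) :
  (mxvec_index i j == mxvec_index p q) = (i == p) && (j == q).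
Proof.
by rewrite /mxvec_index (inj_eq (@cast_ord_inj _ _ _)) (inj_eq enum_rank_inj).
Qed.

Lemma big_mxvec_index (V : nmodType) (m n : nat) (F : 'I_(m * n) -> V) :
  \sum_u F u = \sum_i \sum_j F (mxvec_index i j).
Proof.
rewrite pair_bigA /= (reindex _ (curry_mxvec_bij m n)).
by apply: eq_bigr => -[].
Qed.

Lemma sum_deltal (R : pzSemiRingType) (n : nat) (p : 'I_n) (F : 'I_n -> R) :
  \sum_i (p == i)%:R * F i = F p.
Proof.
rewrite (bigD1 p) //= eqxx mul1r big1 ?addr0 // => i /negPf.
by rewrite eq_sym => ->; rewrite mul0r.
Qed.

Section Vectorization.
Variables (R : realType) (n : nat).
Implicit Types (A B X Y : 'M[R]_n) (Z : 'M[R]_(n * n)).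

Lemma veccE X a b : vecc X (mxvec_index b a) 0 = X a b.
Proof. by rewrite mxE mxvecE mxE. Qed.

Lemma vecc_inj : injective (@vecc R n).
Proof. by move=> X Y eXY; apply/matrixP => a b; rewrite -!veccE eXY. Qed.

Lemma vecc_surj (v : 'cV[R]_(n * n)) : exists X, v = vecc X.
Proof.
exists (\matrix_(a, b) v (mxvec_index b a) 0); apply/colP => u.
by case/mxvec_indexP: u => b a; rewrite veccE mxE.
Qed.

Lemma veccD X Y : vecc (X + Y) = vecc X + vecc Y.
Proof.
by apply/colP => u; case/mxvec_indexP: u => b a; rewrite [RHS]mxE !veccE mxE.
Qed.

Lemma veccZ c X : vecc (c *: X) = c *: vecc X.
Proof.
by apply/colP => u; case/mxvec_indexP: u => b a; rewrite [RHS]mxE !veccE mxE.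
Qed.

Lemma kronE A B p a q b :
  kron A B (mxvec_index p a) (mxvec_index q b) = A p q * B a b.
Proof.
(* The matrix unit in each summand splits into four indicators, one per index, so that [sum_deltal]
   collapses the four sums in turn. *)
transitivity (\sum_i (p == i)%:R * \sum_j (q == j)%:R * \sum_c (a == c)%:R *
  \sum_d (b == d)%:R * (A i j * B c d)); last by rewrite !sum_deltal.
rewrite summxE; apply: eq_bigr => i _; rewrite summxE mulr_sumr.
apply: eq_bigr => j _; rewrite summxE !mulr_sumr.
apply: eq_bigr => c _; rewrite summxE !mulr_sumr.
apply: eq_bigr => d _; rewrite !mxE !eq_mxvec_index.
by do 4!case: (_ == _); rewrite /= ?(mulr1, mul1r, mulr0, mul0r).
Qed.

Lemma kron_vecc A B X : kron A B *m vecc X = vecc (B *m X *m A^T).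
Proof.
apply/colP => u; case/mxvec_indexP: u => p a; rewrite veccE mxE big_mxvec_index.
rewrite mxE; apply: eq_bigr => q _; rewrite [_^T _ _]mxE mxE mulr_suml.
by apply: eq_bigr => b _; rewrite kronE veccE; ring.
Qed.

Lemma commPi_vecc X : commPi R n *m vecc X = vecc X^T.
Proof.
apply/colP => u; case/mxvec_indexP: u => p a; rewrite veccE mulmx_suml summxE.
transitivity (\sum_i (a == i)%:R * \sum_j (p == j)%:R * X j i);
  last by rewrite !sum_deltal mxE.
apply: eq_bigr => i _; rewrite mulmx_suml summxE mulr_sumr.
apply: eq_bigr => j _; rewrite mxE (bigD1 (mxvec_index i j)) //= big1 => [|v].
  rewrite veccE mxE eq_mxvec_index eqxx addr0.
  by do 2!case: (_ == _); rewrite /= ?(mulr1, mul1r, mulr0, mul0r).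
by rewrite mxE => /negPf->; rewrite andbF mul0r.
Qed.

Lemma Pik_vecc k X : Pik R k *m vecc X = col k X.
Proof.
apply/colP => a; rewrite mulmx_suml summxE mxE.
rewrite -[RHS](sum_deltal a (fun c => X c k)).
apply: eq_bigr => c _; rewrite mxE (bigD1 (mxvec_index k c)) //= big1 => [|v].
  by rewrite veccE mxE eqxx andbT addr0.
by rewrite mxE => /negPf->; rewrite andbF mul0r.
Qed.

(** Block row [k] of [Z] acts on the stacked columns of [X]. With [Z = L] this produces agent [k]'s
    column of the stable [W]. *)
Lemma Pik_mulmx_vecc k Z X :
  Pik R k *m (Z *m vecc X) = \sum_j blk Z k j *m col j X.
Proof.
have [Y ZX] := vecc_surj (Z *m vecc X); rewrite ZX Pik_vecc.
apply/colP => a; rewrite mxE -veccE -ZX mxE summxE big_mxvec_index.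
by apply: eq_bigr => j _; rewrite mxE; apply: eq_bigr => b _; rewrite veccE !mxE.
Qed.

End Vectorization.

(** * Inner products and a first-order condition *)

Section Dot.
Variable R : realType.

Definition dot n (x y : 'cV[R]_n) : R := (x^T *m y) 0 0.

Lemma dotE n (x y : 'cV[R]_n) : dot x y = \sum_i x i 0 * y i 0.
Proof. by rewrite /dot mxE; apply: eq_bigr => i _; rewrite mxE. Qed.

Lemma dotC n (x y : 'cV[R]_n) : dot x y = dot y x.
Proof. by rewrite !dotE; apply: eq_bigr => i _; rewrite mulrC. Qed.

Lemma dotDr n (x y z : 'cV[R]_n) : dot x (y + z) = dot x y + dot x z.
Proof. by rewrite /dot mulmxDr mxE. Qed.

Lemma dotDl n (x y z : 'cV[R]_n) : dot (x + y) z = dot x z + dot y z.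
Proof. by rewrite dotC dotDr !(dotC z). Qed.

Lemma dotNr n (x y : 'cV[R]_n) : dot x (- y) = - dot x y.
Proof. by rewrite /dot mulmxN mxE. Qed.

Lemma dotZr n c (x y : 'cV[R]_n) : dot x (c *: y) = c * dot x y.
Proof. by rewrite /dot -scalemxAr mxE. Qed.

Lemma dotZl n c (x y : 'cV[R]_n) : dot (c *: x) y = c * dot x y.
Proof. by rewrite dotC dotZr dotC. Qed.

Lemma dot_trmx m n (A : 'M[R]_(m, n)) x y : dot x (A^T *m y) = dot (A *m x) y.
Proof. by rewrite /dot trmx_mul mulmxA. Qed.

Lemma dot_ge0 n (x : 'cV[R]_n) : 0 <= dot x x.
Proof. by rewrite dotE sumr_ge0 // => i _; rewrite -expr2 sqr_ge0. Qed.

Lemma dot_eq0 n (x : 'cV[R]_n) : dot x x = 0 -> x = 0.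
Proof.
move=> /eqP; rewrite dotE psumr_eq0 => [/allP x0|i _]; last first.
  by rewrite -expr2 sqr_ge0.
apply/colP => i; rewrite mxE; apply/eqP.
by have /(_ (mem_index_enum _)) := x0 i; rewrite -expr2 sqrf_eq0.
Qed.

Lemma col_mulmx (p m n : nat) (A : 'M[R]_(p, m)) (B : 'M[R]_(m, n)) j :
  col j (A *m B) = A *m col j B.
Proof. by rewrite !colE mulmxA. Qed.

Lemma mxtrace_trmx_mul m n (A B : 'M[R]_(m, n)) :
  \tr (A^T *m B) = \sum_i dot (col i A) (col i B).
Proof.
apply: eq_bigr => i _; rewrite mxE dotE; apply: eq_bigr => j _.
by rewrite !mxE.
Qed.

(* Testing the hypothesis on [h = t g] with [t] small gives [g^T g <= 0]. *)
Lemma quadratic_le0 n (Q : 'M[R]_n) (g : 'cV[R]_n) :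
  (forall h, dot h g <= dot h (Q *m h)) -> g = 0.
Proof.
move=> le_gQ; apply: dot_eq0; apply/eqP; rewrite eq_le dot_ge0 andbT leNgt.
apply/negP => g_gt0; set a := dot g g in g_gt0.
set q := dot g (Q *m g).
have le_t t : t * a <= t * (t * q).
  by have := le_gQ (t *: g); rewrite -scalemxAr !dotZl dotZr.
(* Taking [t = 1] gives [q >= a > 0], so [t = a / (2 * q)] is positive; there the bound reads
   [a <= a / 2]. *)
have q_gt0 : 0 < q by have := le_t 1; rewrite !mul1r; exact: lt_le_trans.
have t_gt0 : 0 < a / (2 * q) by rewrite divr_gt0 // mulr_gt0.
have := le_t (a / (2 * q)); rewrite ler_pM2l //.
have -> : a / (2 * q) * q = a / 2 by field; exact: lt0r_neq0.
by lra.
Qed.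

End Dot.

(** * Stable points and the utility as a quadratic *)

Section StablePoint.
Variables (R : realType) (n : nat) (Sigma : 'M[R]_n) (gamma : 'I_n -> R).
Hypothesis SigmaT : Sigma^T = Sigma.
Hypothesis Sigma_gt0 :
  forall x : 'cV[R]_n, x != 0 -> 0 < (x^T *m Sigma *m x) 0 0.
Hypothesis gamma_gt0 : forall i, 0 < gamma i.
Local Notation G := (Gam gamma).
Local Notation K := (Kmat Sigma gamma).
Local Notation L := (Lmat Sigma gamma).
Implicit Types (X W P M : 'M[R]_n).

Lemma dot_Sigma_ge0 (x : 'cV[R]_n) : 0 <= dot x (Sigma *m x).
Proof.
have [->|/Sigma_gt0/ltW] := eqVneq x 0; last by rewrite /dot mulmxA.
by rewrite mulmx0 /dot mulmx0 mxE.
Qed.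

Lemma dot_SigmaC (x y : 'cV[R]_n) : dot x (Sigma *m y) = dot y (Sigma *m x).
Proof. by rewrite -{1}SigmaT dot_trmx dotC. Qed.

(** Column [i] of [Sigma *m X *m G] is [gamma i] times [Sigma *m col i X]. Trace pairings thus
    become sums of nonnegative terms, the source of both the invertibility of [K] and the positivity
    of [T^(k,k)]. *)
Lemma mxtrace_Sigma_Gam X :
  \tr (X^T *m (Sigma *m X *m G)) =
    \sum_i gamma i * dot (col i X) (Sigma *m col i X).
Proof.
rewrite mxtrace_trmx_mul; apply: eq_bigr => i _; rewrite -dotZr; congr dot.
by apply/colP => a; rewrite -col_mulmx /Gam mul_mx_diag !mxE mulrC.
Qed.

Lemma trGam : G^T = G. Proof. exact: tr_diag_mx. Qed.

(** Transposition and cyclicity of the trace reduce this to [mxtrace_Sigma_Gam] at [X^T]. *)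
Lemma mxtrace_Gam_Sigma X :
  \tr (X^T *m (G *m X *m Sigma)) =
    \sum_i gamma i * dot (col i X^T) (Sigma *m col i X^T).
Proof.
rewrite -mxtrace_Sigma_Gam trmxK -mxtrace_tr !trmx_mul
  trmxK trGam SigmaT !mulmxA mxtrace_mulC.
by rewrite !mulmxA mxtrace_mulC !mulmxA.
Qed.

Lemma Kmat_vecc X : K *m vecc X = vecc (Sigma *m X *m G + G *m X *m Sigma).
Proof. by rewrite mulmxDl !kron_vecc trGam SigmaT -veccD. Qed.

Lemma Sigma_sum_ge0 X :
  0 <= \sum_i gamma i * dot (col i X) (Sigma *m col i X).
Proof.
by apply: sumr_ge0 => i _; rewrite mulr_ge0 ?dot_Sigma_ge0 // ltW.
Qed.

(** If [K] annihilates [vecc X], pairing with [X] makes two nonnegative sums add up to 0. The first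
    then vanishes term by term, and positive definiteness kills each column of [X]. *)
Lemma Kmat_unit : K \in unitmx.
Proof.
(* [kermx] is a left kernel, hence the passage to the transpose of [K]. *)
rewrite -unitmx_tr -row_free_unit -kermx_eq0; apply/eqP/row_matrixP => i.
rewrite row0; set v := row i _.
have Kv : K *m v^T = 0.
  by apply: trmx_inj; rewrite trmx_mul trmxK -row_mul mulmx_ker row0 trmx0.
have [X vX] := vecc_surj v^T; apply: trmx_inj; rewrite vX trmx0.
have X0 : Sigma *m X *m G + G *m X *m Sigma = 0.
  apply: vecc_inj; rewrite -Kmat_vecc -vX Kv.
  by apply/colP => u; case/mxvec_indexP: u => b a; rewrite veccE !mxE.
have tr0 : \sum_i gamma i * dot (col i X) (Sigma *m col i X) == 0.
  have := congr1 (fun Y => \tr (X^T *m Y)) X0.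
  rewrite mulmx0 mxtrace0 mulmxDr mxtraceD mxtrace_Sigma_Gam mxtrace_Gam_Sigma.
  by move: (Sigma_sum_ge0 X) (Sigma_sum_ge0 X^T) => ? ? ?; apply/eqP; lra.
suff -> : X = 0.
  by apply/colP => u; case/mxvec_indexP: u => b a; rewrite veccE !mxE.
apply/matrixP => a b; move: tr0; rewrite psumr_eq0 => [/allP/(_ b)|j _]; last first.
  by rewrite mulr_ge0 ?dot_Sigma_ge0 // ltW.
rewrite mem_index_enum => /(_ isT); rewrite mulf_eq0 gt_eqF //= => colX.
have [/colP/(_ a)|/Sigma_gt0] := eqVneq (col b X) 0; first by rewrite !mxE.
by rewrite -mulmxA -/(dot _ _) (eqP colX) ltxx.
Qed.

(** Adding the transpose cancels the antisymmetric [P]. *)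
Lemma stable_point_sym M' W P : is_stable_point Sigma gamma M' W P ->
  M' + M'^T = 2 *: (Sigma *m W *m G + G *m W *m Sigma).
Proof.
move=> [WT [PT /(canRL (subrK _)) M'E]].
rewrite M'E linearD /= linearZ /= !trmx_mul trGam WT SigmaT PT scalerDr mulmxA.
by rewrite addrACA subrr addr0.
Qed.

Lemma Lmat_vecc X : L *m vecc X = 2^-1 *: (invmx K *m vecc (X + X^T)).
Proof. by rewrite -scalemxAl mulmxDl -mulmxA commPi_vecc -mulmxDr veccD. Qed.

Lemma stable_point_vecc M' W P : is_stable_point Sigma gamma M' W P ->
  vecc W = L *m vecc M'.
Proof.
move=> sp; rewrite Lmat_vecc (stable_point_sym sp) veccZ -Kmat_vecc -scalemxAr.
by rewrite mulKmx ?Kmat_unit // scalerA mulVf ?scale1r // pnatr_eq0.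
Qed.

Lemma stable_point_col k M' W P : is_stable_point Sigma gamma M' W P ->
  col k W = \sum_j blk L k j *m col j M'.
Proof. by move=> /stable_point_vecc WE; rewrite -Pik_vecc WE Pik_mulmx_vecc. Qed.

Lemma stable_point_utility k M M' W P : is_stable_point Sigma gamma M' W P ->
  utility Sigma gamma M k W P =
    gamma k * dot (col k W) (Sigma *m col k W)
    - dot (col k W) (col k M' - col k M).
Proof.
move=> [_ [_ /(canRL (subrK _)) M'E]].
have -> : col k M' = (2 * gamma k) *: (Sigma *m col k W) + col k P.
  rewrite M'E linearD /=; congr (_ + _); apply/colP => a.
  by rewrite -col_mulmx /Gam mul_mx_diag !mxE; ring.
rewrite /utility mxE -/(dot _ _) mxE mxE -mulmxA -/(dot _ _).
by rewrite !(dotDr, dotNr, dotZr); ring.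
Qed.

(** Read at the truthful stable point, [yvec] is the part of the gradient due to the true beliefs,
    up to sign. *)
Lemma yvecE k M W P : is_stable_point Sigma gamma M W P ->
  yvec Sigma gamma M k =
    - ((1%:M - (2 * gamma k) *: ((blk L k k)^T *m Sigma)) *m col k W).
Proof.
move=> /stable_point_vecc WE; rewrite /yvec -!mulmxA -mulNmx opprB -Pik_vecc WE.
by rewrite Lmat_vecc -!scalemxAr.
Qed.

Lemma dot_Tblk k x y : dot x (Tblk Sigma gamma k k *m y) =
  dot x (blk L k k *m y) + dot (blk L k k *m x) y
  - 2 * gamma k * dot (blk L k k *m x) (Sigma *m (blk L k k *m y)).
Proof.
rewrite /Tblk eqxx !mulmxDl mulNmx -scalemxAl -!mulmxA.
by rewrite !(dotDr, dotNr, dotZr) !dot_trmx.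
Qed.

(* If only agent [k] reports, with position [h], then pairing the stability
   equation with [W] gives [h^T w_k = 2 sum_i gamma_i w_i^T Sigma w_i]. *)
Lemma Tblk_ge0 (sp : forall M', exists WP : 'M[R]_n * 'M[R]_n,
    is_stable_point Sigma gamma M' WP.1 WP.2) k h :
  0 <= dot h (Tblk Sigma gamma k k *m h).
Proof.
(* This report has [h] as column [k] and zeros elsewhere. *)
have [[W P] /= spW] := sp (h *m delta_mx 0 k : 'M[R]_n).
have colh j : col j (h *m delta_mx 0 k : 'M[R]_n) = (k == j)%:R *: h.
  apply/colP => a; rewrite !mxE big_ord1 !mxE eqxx /= eq_sym.
  by case: (k == j); rewrite ?(mulr1, mulr0, mul1r, mul0r).
have w_k : col k W = blk L k k *m h.
  rewrite (stable_point_col k spW) (bigD1 k) //= colh eqxx scale1r.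
  rewrite big1 ?addr0 // => j /negPf; rewrite colh eq_sym => ->.
  by rewrite scale0r mulmx0.
have [WT [_ _]] := spW.
have := congr1 (fun Y => \tr (W^T *m Y)) (stable_point_sym spW).
rewrite mulmxDr mxtraceD -scalemxAr mxtraceZ mulmxDr mxtraceD.
rewrite mxtrace_Gam_Sigma mxtrace_Sigma_Gam WT.
have trW : \tr (W^T *m (h *m delta_mx 0 k : 'M[R]_n)) = dot (col k W) h.
  rewrite mxtrace_trmx_mul (bigD1 k) //= colh eqxx scale1r big1 ?addr0 // => j.
  by rewrite eq_sym => /negPf jk; rewrite colh jk scale0r /dot mulmx0 mxE.
have trWT : \tr (W^T *m (h *m delta_mx 0 k : 'M[R]_n)^T) = dot (col k W) h.
  by rewrite -trmx_mul mxtrace_tr mxtrace_mulC -[X in X *m _]WT.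
rewrite -[X in X *m (h *m _)]WT trW -[X in X *m (h *m _)^T]WT trWT.
rewrite dot_Tblk -w_k dotC (bigD1 k) //=.
(* With [q = dot (col k W) (Sigma *m col k W)], [trE] amounts to [h^T w_k = 2 (gamma_k q + s)], so
   the goal's form equals [2 gamma_k q + 4 s]. *)
set s := \sum_(i | _) _ => trE.
have s_ge0 : 0 <= s.
  by apply: sumr_ge0 => i _; rewrite mulr_ge0 ?dot_Sigma_ge0 // ltW.
have := mulr_ge0 (ltW (gamma_gt0 k)) (dot_Sigma_ge0 (col k W)).
by move: trE; lra.
Qed.

(* With [A = L^(k,k)] and [b] the part of [w_k] that does not depend on
   [delta_k], agent [k]'s utility is [w_k^T (gamma_k Sigma w_k - delta_k)] at
   [w_k = A delta_k + b]. *)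
Definition position_utility k (b d : 'cV[R]_n) : R :=
  let w := blk L k k *m d + b in
  gamma k * dot w (Sigma *m w) - dot w d.

(** The left factor of [T^(k,j)] for [j != k] and, up to sign, of [yvec]. It carries the part of
    [w_k] beyond agent [k]'s control into the gradient. *)
Definition residual_mx k : 'M[R]_n :=
  1%:M - (2 * gamma k) *: ((blk L k k)^T *m Sigma).

(** An exact second-order expansion, the utility being quadratic. Since [b] enters only the term
    linear in [h], averaging this difference over a random [b] involves only its mean. *)
Lemma position_utilityB k b d h :
  position_utility k b (d + h) - position_utility k b d =
    - (2^-1 * dot h (Tblk Sigma gamma k k *m h))
    - dot h (Tblk Sigma gamma k k *m d + residual_mx k *m b).
Proof.
rewrite /position_utility /residual_mx mulmxBl mul1mx -scalemxAl -!mulmxA.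
rewrite !(mulmxDr, dotDl, dotDr, dotNr, dotZr) !dot_Tblk !dot_trmx.
rewrite (dotC (_ *m h) h) (dotC b h) (dotC (_ *m d) h).
rewrite (dot_SigmaC b (_ *m h)) (dot_SigmaC (_ *m d) (_ *m h)).
rewrite (dot_SigmaC b (_ *m d)).
by field.
Qed.

End StablePoint.

(** * Random vectors with entries in [Lfun] *)

Section RandomVectors.
Variables (R : realType) (dT : measure_display) (T : measurableType dT).
Variable Pr : probability T R.

Definition in_Lfun p m (X : T -> 'cV[R]_m) :=
  forall i, (fun w => X w i 0) \in Lfun Pr p.

Definition mean_vec m (X : T -> 'cV[R]_m) : 'cV[R]_m :=
  \col_i fine ('E_Pr[fun w => X w i 0]).

Variables (p : \bar R) (p_ge1 : (1 <= p)%E).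

Lemma Lfun_sum (I : finType) (P : pred I) (F : I -> T -> R) :
  (forall i, P i -> F i \in Lfun Pr p) ->
  (fun w => \sum_(i | P i) F i w) \in Lfun Pr p.
Proof.
move=> LF; rewrite (_ : (fun w => _) = \sum_(i | P i) F i).
  by apply: rpred_sum => //; exact: LF.
by apply/funext => w; rewrite fct_sumE.
Qed.

Lemma LfunZ c (F : T -> R) : F \in Lfun Pr p -> (fun w => c * F w) \in Lfun Pr p.
Proof. by move=> LF; rewrite (_ : (fun w => _) = c *: F) ?rpredZ. Qed.

Lemma in_LfunD m (X Y : T -> 'cV[R]_m) :
  in_Lfun p X -> in_Lfun p Y -> in_Lfun p (fun w => X w + Y w).
Proof.
move=> LX LY i; under eq_fun do rewrite mxE.
exact: (Lfun_addr_closed Pr p_ge1).2 _ _ (LX i) (LY i).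
Qed.

Lemma in_Lfun_mulmx m q (A : 'M[R]_(q, m)) (X : T -> 'cV[R]_m) :
  in_Lfun p X -> in_Lfun p (fun w => A *m X w).
Proof.
move=> LX i; under eq_fun do rewrite mxE.
by apply: Lfun_sum => j _; exact/LfunZ/LX.
Qed.

Lemma in_Lfun_sum m (I : finType) (P : pred I) (X : I -> T -> 'cV[R]_m) :
  (forall i, P i -> in_Lfun p (X i)) ->
  in_Lfun p (fun w => \sum_(i | P i) X i w).
Proof.
move=> LX j; under eq_fun do rewrite summxE.
by apply: Lfun_sum => i Pi; exact: LX.
Qed.

End RandomVectors.

(** * Expectations of random vectors *)

Section Mean.
Variables (R : realType) (dT : measure_display) (T : measurableType dT).
Variable Pr : probability T R.

Local Notation mean X := (fine ('E_Pr[X])).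

Lemma EFin_mean (X : T -> R) : X \in Lfun Pr 1 -> (mean X)%:E = 'E_Pr[X]%E.
Proof. by move=> LX; rewrite fineK // expectation_fin_num. Qed.

Lemma meanZ c (X : T -> R) : X \in Lfun Pr 1 ->
  mean (fun w => c * X w) = c * mean X.
Proof.
move=> LX; rewrite -[RHS]/(fine (c%:E * (mean X)%:E)) EFin_mean // -expectationZl //.
congr (fine (expectation _ _)).
by apply/funext => w /=; rewrite mulrC.
Qed.

Lemma meanB (X Y : T -> R) : X \in Lfun Pr 1 -> Y \in Lfun Pr 1 ->
  mean (fun w => X w - Y w) = mean X - mean Y.
Proof.
by move=> LX LY; rewrite -fineB ?expectation_fin_num // -expectationB.
Qed.

Lemma meanD (X Y : T -> R) : X \in Lfun Pr 1 -> Y \in Lfun Pr 1 ->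
  mean (fun w => X w + Y w) = mean X + mean Y.
Proof.
by move=> LX LY; rewrite -fineD ?expectation_fin_num // -expectationD.
Qed.

Lemma mean_sum (I : finType) (P : pred I) (F : I -> T -> R) :
  (forall i, P i -> F i \in Lfun Pr 1) ->
  mean (fun w => \sum_(i | P i) F i w) = \sum_(i | P i) mean (F i).
Proof.
move=> LF; apply: EFin_inj; rewrite EFin_mean ?Lfun_sum // -sumEFin.
rewrite (eq_bigr (fun i => 'E_Pr[F i]%E)) => [|i /LF]; last exact: EFin_mean.
(* [expectation_sum] ranges over a list of random variables, here the [F i] with [P i]. *)
rewrite -[RHS]big_filter -[RHS](big_map F predT (expectation Pr)).
rewrite -expectation_sum => [|X /mapP[i]]; last first.
  by rewrite mem_filter => /andP[/LF + _] ->.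
by congr expectation; apply/funext => w; rewrite big_map big_filter fct_sumE.
Qed.

Lemma mean_cst c : mean (fun=> c) = c.
Proof. by rewrite (expectation_cst Pr c). Qed.

Lemma mean_vec_mulmx m q (A : 'M[R]_(q, m)) (X : T -> 'cV[R]_m) :
  in_Lfun Pr 1 X -> mean_vec Pr (fun w => A *m X w) = A *m mean_vec Pr X.
Proof.
move=> LX; apply/colP => i; rewrite !mxE; under eq_fun do rewrite mxE.
rewrite mean_sum => [|j _]; last exact/LfunZ/LX.
by apply: eq_bigr => j _; rewrite meanZ ?mxE //; exact: LX.
Qed.

Lemma mean_dot m (h : 'cV[R]_m) (X : T -> 'cV[R]_m) :
  in_Lfun Pr 1 X -> mean (fun w => dot h (X w)) = dot h (mean_vec Pr X).
Proof.
by move=> LX; rewrite /dot -mean_vec_mulmx // mxE.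
Qed.

Lemma mean_vecD m (X Y : T -> 'cV[R]_m) : in_Lfun Pr 1 X -> in_Lfun Pr 1 Y ->
  mean_vec Pr (fun w => X w + Y w) = mean_vec Pr X + mean_vec Pr Y.
Proof.
move=> LX LY; apply/colP => i; rewrite !mxE -meanD; [|exact: LX|exact: LY].
by under eq_fun do rewrite mxE.
Qed.

Lemma mean_vec_sum m (I : finType) (P : pred I) (X : I -> T -> 'cV[R]_m) :
  (forall i, P i -> in_Lfun Pr 1 (X i)) ->
  mean_vec Pr (fun w => \sum_(i | P i) X i w) = \sum_(i | P i) mean_vec Pr (X i).
Proof.
move=> LX; apply/colP => j; rewrite mxE summxE.
under eq_fun do rewrite summxE.
rewrite mean_sum => [|i Pi]; last exact: LX.
by apply: eq_bigr => i _; rewrite mxE.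
Qed.

Lemma mean_vec_cst m (c : 'cV[R]_m) : mean_vec Pr (fun=> c) = c.
Proof. by apply/colP => i; rewrite mxE mean_cst. Qed.

Lemma in_Lfun_cst r m (c : 'cV[R]_m) : in_Lfun Pr r%:E (fun=> c).
Proof. by move=> i; exact: Lfun_cst. Qed.

Lemma in_Lfun12 m (X : T -> 'cV[R]_m) : in_Lfun Pr 2%:E X -> in_Lfun Pr 1 X.
Proof. by move=> LX i; apply: Lfun_subset12 (LX i); exact: fin_num_measure. Qed.

Lemma dot_Lfun1 m (X Y : T -> 'cV[R]_m) :
  in_Lfun Pr 2%:E X -> in_Lfun Pr 2%:E Y -> (fun w => dot (X w) (Y w)) \in Lfun Pr 1.
Proof.
move=> LX LY; under eq_fun do rewrite dotE.
by apply: Lfun_sum => // i _; apply: Lfun2_mul_Lfun1; [exact: LX|exact: LY].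
Qed.

(** This converts the second-moment hypothesis into membership in L^2, where sums and linear images
    stay and products of two members are integrable. *)
Lemma integrable_sqr_Lfun2 (X : T -> R) : measurable_fun setT X ->
  Pr.-integrable setT (fun w => (X w ^+ 2)%:E) -> X \in Lfun Pr 2%:E.
Proof.
move=> mX /integrableP[_ X2]; rewrite inE; apply/andP; split; rewrite inE //=.
rewrite /finite_norm unlock poweR_lty //; apply: le_lt_trans X2.
rewrite le_eqVlt; apply/orP; left; apply/eqP; apply: eq_integral => w _ /=.
by rewrite normrX powR_mulrn.
Qed.

End Mean.

(** * Maximizers of concave quadratics and the linear system *)

Lemma argmax_quadratic (R : realType) n (u : 'cV[R]_n -> R) (Q : 'M[R]_n) d g :
  (forall h, 0 <= dot h (Q *m h)) ->
  (forall h, u (d + h) - u d = - (2^-1 * dot h (Q *m h)) - dot h g) ->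
  (forall d', u d' <= u d) <-> g = 0.
Proof.
move=> Q_ge0 uB; split=> [u_max|g0 d'].
  (* Moving by [- h] flips the linear term, so maximality bounds [dot h g] by half the quadratic
     form. *)
  apply: (@quadratic_le0 _ _ (2^-1 *: Q)) => h.
  have := u_max (d + - h); rewrite -subr_le0 uB mulmxN dotNr.
  rewrite (dotC (- h)) (dotC (- h)) !dotNr opprK (dotC _ h) (dotC g).
  by rewrite -scalemxAl dotZr; lra.
have := uB (d' - d); rewrite subrKC g0 {2}/dot mulmx0 mxE subr0.
by have := Q_ge0 (d' - d); lra.
Qed.

Theorem mainTheorem6 (R : realType) (n : nat)
  (Sigma : 'M[R]_n) (gamma : 'I_n -> R) (M : 'M[R]_n)
  (S : {set 'I_n}) (k : 'I_n)
  (dT : measure_display) (T : measurableType dT) (Pr : probability T R)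
  (delta : 'I_n -> T -> 'cV[R]_n)
  (sp : 'M[R]_n -> 'M[R]_n * 'M[R]_n) :
  Sigma^T = Sigma ->
  (forall x : 'cV[R]_n, x != 0 -> 0 < (x^T *m Sigma *m x) 0 0) ->
  (forall i, 0 < gamma i) ->
  k \in S ->
  (* finite first and second moments of the random delta_j, j in S \ {k} *)
  (forall j i, j \in S -> j != k ->
     measurable_fun setT (fun w => delta j w i 0) /\
     Pr.-integrable setT (fun w => (delta j w i 0)%:E) /\
     Pr.-integrable setT (fun w => ((delta j w i 0) ^+ 2)%:E)) ->
  (* sp M' is the stable point for M' *)
  (forall M' : 'M[R]_n, is_stable_point Sigma gamma M' (sp M').1 (sp M').2) ->
  forall d : 'cV[R]_n,
    (forall d' : 'cV[R]_n,
       ('E_Pr[fun w => let WP := sp (M + Delta S k delta d' w)%R in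
                        utility Sigma gamma M k WP.1 WP.2] <=
        'E_Pr[fun w => let WP := sp (M + Delta S k delta d w)%R in
                        utility Sigma gamma M k WP.1 WP.2])%E)
    <->
    Tblk Sigma gamma k k *m d
      + \sum_(j < n | (j \in S) && (j != k))
           Tblk Sigma gamma k j *m (\col_i fine ('E_Pr[fun w => delta j w i 0]))
    = yvec Sigma gamma M k.
Proof.
move=> SigmaT Sigma_gt0 gamma_gt0 _ moments spP d.
set L := Lmat Sigma gamma; set N := residual_mx Sigma gamma k.
(* [w0] is the truthful column; [b] adds the effect of the other agents' reports, so [w_k] is [b]
   plus the block [L^(k,k)] applied to agent [k]'s own report. *)
pose w0 := col k (sp M).1.
pose b w := w0 + \sum_(j | (j \in S) && (j != k)) blk L k j *m delta j w.
have L2delta j : (j \in S) && (j != k) -> in_Lfun Pr 2%:E (delta j).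
  move=> /andP[jS jk] i; have [? [_ ?]] := moments j i jS jk.
  exact: integrable_sqr_Lfun2.
have ge12 : (1 <= 2%:E :> \bar R)%E by rewrite lee1n.
have L2b : in_Lfun Pr 2%:E b.
  apply: in_LfunD => //; first exact: in_Lfun_cst.
  by apply: in_Lfun_sum => // j /L2delta; exact: in_Lfun_mulmx.
have mean_b : mean_vec Pr b =
    w0 + \sum_(j | (j \in S) && (j != k)) blk L k j *m mean_vec Pr (delta j).
  have L1 j : (j \in S) && (j != k) -> in_Lfun Pr 1 (delta j).
    by move/L2delta/in_Lfun12.
  rewrite mean_vecD ?mean_vec_cst ?mean_vec_sum; first congr (_ + _).
  - by apply: eq_bigr => j /L1 ?; rewrite mean_vec_mulmx.
  - by move=> j /L1; exact: in_Lfun_mulmx.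
  - exact: in_Lfun_cst.
  - by apply: in_Lfun_sum => // j /L1; exact: in_Lfun_mulmx.
pose U d' w := position_utility Sigma gamma k (b w) d'.
have utilityE d' : (fun w => let WP := sp (M + Delta S k delta d' w) in
    utility Sigma gamma M k WP.1 WP.2) = U d'.
  apply/funext => w /=; have spW := spP (M + Delta S k delta d' w).
  rewrite (stable_point_utility _ _ spW) /U /position_utility.
  have -> : col k (M + Delta S k delta d' w) - col k M = d'.
    by apply/colP => i; rewrite !mxE eqxx addrC addKr.
  suff -> : col k (sp (M + Delta S k delta d' w)).1 = blk L k k *m d' + b w by [].
  rewrite (stable_point_col SigmaT Sigma_gt0 gamma_gt0 k spW) /b /w0.
  rewrite (stable_point_col SigmaT Sigma_gt0 gamma_gt0 k (spP M)) addrCA.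
  rewrite (eq_bigr (fun j => blk L k j *m col j M +
    blk L k j *m col j (Delta S k delta d' w))) => [|j _]; last first.
    by rewrite linearD mulmxDr.
  rewrite big_split /=; congr (_ + _).
  rewrite (bigD1 k) //=; congr (_ *m _ + _).
    by apply/colP => i; rewrite !mxE eqxx.
  rewrite [RHS]big_mkcondl; apply: eq_bigr => j /negPf jk.
  have [jS|jS] := boolP (j \in S).
    by congr (_ *m _); apply/colP => i; rewrite !mxE jk jS.
  rewrite (_ : col j _ = 0) ?mulmx0 //.
  by apply/colP => i; rewrite !mxE jk (negPf jS).
(* The utility contains a quadratic form in the random [b], integrable because [b] is in L^2. *)
have L1U d' : U d' \in Lfun Pr 1.
  have L2w : in_Lfun Pr 2%:E (fun w => blk L k k *m d' + b w).
    by apply: in_LfunD => //; exact: in_Lfun_cst.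
  have ? : (fun w => gamma k * dot (blk L k k *m d' + b w)
      (Sigma *m (blk L k k *m d' + b w))) \in Lfun Pr 1.
    by apply: LfunZ => //; apply: dot_Lfun1 => //; exact: in_Lfun_mulmx.
  have ? : (fun w => dot (blk L k k *m d' + b w) d') \in Lfun Pr 1.
    by apply: dot_Lfun1 => //; exact: in_Lfun_cst.
  by rewrite -[U d']/((fun w => _ * dot _ _) - (fun w => dot _ _)) rpredB.
pose u d' := fine ('E_Pr[U d']).
have uE d' : (u d')%:E = 'E_Pr[U d']%E by exact: EFin_mean.
have uB h : u (d + h) - u d =
    - (2^-1 * dot h (Tblk Sigma gamma k k *m h))
    - dot h (Tblk Sigma gamma k k *m d + N *m mean_vec Pr b).
  have L1b := in_Lfun12 L2b.
  rewrite /u -meanB //; under eq_fun do rewrite position_utilityB //.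
  rewrite meanB; last 2 first.
  - exact: Lfun_cst.
  - apply: (dot_Lfun1 (X := fun=> h)); first exact: in_Lfun_cst.
    by apply: in_LfunD => //; [exact: in_Lfun_cst|exact: in_Lfun_mulmx].
  have L1Nb : in_Lfun Pr 1 (fun w => N *m b w) by exact: in_Lfun_mulmx.
  rewrite mean_cst mean_dot; last first.
    by apply: in_LfunD => //; exact: in_Lfun_cst.
  by rewrite mean_vecD ?mean_vec_cst ?mean_vec_mulmx //; exact: in_Lfun_cst.
have T_ge0 := Tblk_ge0 SigmaT Sigma_gt0 gamma_gt0
  (fun M' => ex_intro _ (sp M') (spP M')) k.
have eq_sum : \sum_(j | (j \in S) && (j != k)) Tblk Sigma gamma k j *m
    (\col_i fine ('E_Pr[fun w => delta j w i 0])) =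
    N *m \sum_(j | (j \in S) && (j != k)) blk L k j *m mean_vec Pr (delta j).
  rewrite mulmx_sumr; apply: eq_bigr => j /andP[_ /negPf jk].
  by rewrite /Tblk jk mulmxA.
rewrite eq_sum (yvecE SigmaT Sigma_gt0 gamma_gt0 k (spP M)).
(* The gradient condition is regrouped with [N *m w0] last; moved across, it becomes [yvec] by
   [yvecE]. *)
have := argmax_quadratic T_ge0 uB; rewrite mean_b mulmxDr addrCA addrC => u_max.
(* Integrability makes both expectations finite, so the extended-real comparison is one of reals. *)
transitivity (forall d', u d' <= u d).
  by split=> le_u d'; have := le_u d'; rewrite !utilityE -!uE lee_fin.
by rewrite u_max; split=> [/eqP|->]; rewrite ?addNr // addr_eq0 => /eqP.
Qed.
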